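(* Let $q,a,b,c\in\mathbb{C}$ with $cq^N\neq 1$ for every integer $N\geq 0$. If $|q|<1$ and $|c|<|ab|$, then $$\phi_q\!\left(a,b;c;\frac{c}{ab}\right)=\frac{(c/a;q)_\infty\,(c/b;q)_\infty}{(c;q)_\infty\,(c/ab;q)_\infty},$$ where $c/ab$ denotes $c/(ab)$.
   Context: For $u,q\in\mathbb{C}$ with $|q|<1$, $(u;q)_n=\prod_{k=0}^{n-1}(1-uq^k)$ (with $(u;q)_0=1$) and $(u;q)_\infty=\prod_{k=0}^{\infty}(1-uq^k)$. For $|q|<1$, $|z|<1$ and $c$ with $cq^N\neq1$ for every integer $N\geq 0$, the $q$-hypergeometric series is $$\phi_q(a,b;c;z)=\sum_{n=0}^{\infty}\frac{(a;q)_n(b;q)_n}{(c;q)_n}\,\frac{z^n}{(q;q)_n},$$ where $a,b$ are the upper parameters, $c$ the lower parameter and $z$ the variable. *)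

(* Defs.v *)
From Stdlib Require Import Reals Lra Lia.
From Coquelicot Require Import Coquelicot.

Open Scope C_scope.

Fixpoint qPoch (u q : C) (n : nat) : C :=
  match n with
  | O => 1
  | S m => qPoch u q m * (1 - u * q ^ m)
  end.

Definition is_qPoch_inf (u q l : C) : Prop :=
  filterlim (qPoch u q) eventually (@locally C_NormedModule l).

(* [iota P] is the unique point satisfying [P] when there is one; the limit
   exists for every [u] as soon as [Cmod q < 1], see [qPoch_inf_correct]. *)
Definition qPoch_inf (u q : C) : C :=
  @iota C_CompleteNormedModule (is_qPoch_inf u q).

Definition qhyp_term (q a b c z : C) (n : nat) : C :=
  (qPoch a q n * qPoch b q n) / qPoch c q n * (z ^ n / qPoch q q n).

(* A total function: it is the sum of the series only where
   [ex_series (qhyp_term q a b c z)] holds. *)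
Definition qhyp (q a b c z : C) : C :=
  @iota C_CompleteNormedModule
    (@is_series C_AbsRing C_NormedModule (qhyp_term q a b c z)).

Lemma Cmod_Cpow (x : C) (n : nat) : Cmod (x ^ n) = (Cmod x ^ n)%R.
Proof.
induction n as [|n IH]; simpl.
- apply Cmod_1.
- now rewrite Cmod_mult, IH.
Qed.

Lemma qPoch_bound (u q : C) (n : nat) : (Cmod q < 1)%R ->
  (Cmod (qPoch u q n) <= exp (Cmod u / (1 - Cmod q)))%R.
Proof.
intros Hq.
assert (Hq0 := Cmod_ge_0 q); assert (Hu0 := Cmod_ge_0 u).
apply Rle_trans with
  (exp (Cmod u * ((1 - Cmod q ^ n) / (1 - Cmod q)))).
- induction n as [|n IH].
  + simpl; rewrite Cmod_1.
    replace (Cmod u * ((1 - 1) / (1 - Cmod q)))%R with 0%R by (field; lra).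
    rewrite exp_0; lra.
  + replace (Cmod u * ((1 - Cmod q ^ S n) / (1 - Cmod q)))%R
      with (Cmod u * ((1 - Cmod q ^ n) / (1 - Cmod q))
            + Cmod u * Cmod q ^ n)%R by (simpl; field; lra).
    rewrite exp_plus; simpl qPoch; rewrite Cmod_mult.
    apply Rmult_le_compat; try apply Cmod_ge_0; trivial.
    apply Rle_trans with (1 + Cmod u * Cmod q ^ n)%R.
    * unfold Cminus; eapply Rle_trans; [apply Cmod_triangle|].
      rewrite Cmod_opp, Cmod_mult, Cmod_Cpow, Cmod_1; lra.
    * apply exp_ineq1_le.
- assert (exp_le : forall x y : R, (x <= y)%R -> (exp x <= exp y)%R).
  { intros x y [H | ->]; [left; now apply exp_increasing | apply Rle_refl]. }
  apply exp_le; unfold Rdiv; apply Rmult_le_compat_l; trivial.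
  rewrite <- (Rmult_1_l (/ (1 - Cmod q))) at 2.
  apply Rmult_le_compat_r.
  + left; apply Rinv_0_lt_compat; lra.
  + assert (H := pow_le (Cmod q) n Hq0); lra.
Qed.

Lemma ex_qPoch_inf (u q : C) : (Cmod q < 1)%R -> exists l, is_qPoch_inf u q l.
Proof.
intros Hq.
assert (Hq0 := Cmod_ge_0 q).
set (B := exp (Cmod u / (1 - Cmod q))).
set (d := fun n => - (qPoch u q n * (u * q ^ n))).
assert (Hd : @ex_series C_AbsRing C_CompleteNormedModule d).
{ apply (@ex_series_le C_AbsRing C_CompleteNormedModule d
           (fun n => (B * Cmod u) * Cmod q ^ n)%R).
  - intros n; change (Cmod (d n) <= B * Cmod u * Cmod q ^ n)%R.
    unfold d; rewrite Cmod_opp, !Cmod_mult, Cmod_Cpow, Rmult_assoc.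
    apply Rmult_le_compat_r.
    + apply Rmult_le_pos; [apply Cmod_ge_0 | now apply pow_le].
    + now apply qPoch_bound.
  - apply (@ex_series_scal R_AbsRing R_NormedModule).
    apply ex_series_geom; rewrite Rabs_pos_eq; trivial. }
assert (Hsum : forall n, 1 + @sum_n C_AbelianMonoid d n = qPoch u q (S n)).
{ induction n as [|n IH].
  - rewrite sum_O; unfold d; simpl; ring.
  - rewrite sum_Sn; change plus with Cplus.
    rewrite Cplus_assoc, IH; unfold d.
    change (qPoch u q (S (S n))) with
      (qPoch u q (S n) * (1 - u * q ^ S n)); ring. }
destruct Hd as [l Hl].
exists (1 + l); unfold is_qPoch_inf.
assert (H1 : filterlim (fun n => qPoch u q (S n)) eventually
               (@locally C_NormedModule (1 + l))).
{ eapply filterlim_ext; [exact Hsum|].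
  apply (filterlim_comp_2 (F := eventually)
           (G := @locally C_NormedModule (RtoC 1))
           (H := @locally C_NormedModule l)
           (fun _ => RtoC 1) (@sum_n C_AbelianMonoid d) Cplus).
  - apply filterlim_const.
  - exact Hl.
  - apply (@filterlim_plus C_AbsRing C_NormedModule). }
intros P HP; destruct (H1 P HP) as [N HN].
exists (S N); intros [|n] Hn; [lia | apply HN; lia].
Qed.

Lemma qPoch_inf_correct (u q : C) : (Cmod q < 1)%R ->
  is_qPoch_inf u q (qPoch_inf u q).
Proof.
intros Hq; destruct (ex_qPoch_inf u q Hq) as [l Hl].
replace (qPoch_inf u q) with l; trivial.
symmetry.
exact (@iota_filterlim_locally C_AbsRing C_CompleteNormedModule nat
         eventually _ (qPoch u q) l Hl).
Qed.

(* Main.v *)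
Require Import Defs.
From Stdlib Require Import Reals Lra.
From Coquelicot Require Import Coquelicot.

Open Scope C_scope.

(** Let [F c] be the sum of the series at the argument [c / (a * b)]. A
    telescoping identity between the terms for [c] and for [c * q] gives
    [(1 - c) (1 - c / (a b)) F c = (1 - c / a) (1 - c / b) F (c q)].
    Iterating it [N] times turns the four factors into q-Pochhammer symbols of
    length [N], and [F (c q^N)] tends to [1], because its terms are dominated
    by those of a geometric series uniformly in [N]. *)

(** * Limits of complex sequences *)

(** This unfolds to the same [filterlim] as [is_qPoch_inf] and as [is_series] on partial sums, so
    those facts are used as [Clim] facts by conversion. *)
Definition Clim (u : nat -> C) (l : C) : Prop :=
  filterlim u eventually (@locally C_NormedModule l).

Lemma Clim_Cmod_minus (u : nat -> C) (l : C) :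
  Clim u l <-> is_lim_seq (fun n => Cmod (u n - l)) 0.
Proof.
unfold Clim.
rewrite (@filterlim_locally_ball_norm C_AbsRing nat C_NormedModule eventually _).
rewrite <- is_lim_seq_spec; unfold is_lim_seq'.
split; intros H eps; destruct (H eps) as [N HN]; exists N; intros n Hn;
  specialize (HN n Hn).
- rewrite Rminus_0_r, Rabs_pos_eq by apply Cmod_ge_0.
  exact HN.
- rewrite Rminus_0_r, Rabs_pos_eq in HN by apply Cmod_ge_0.
  exact HN.
Qed.

Lemma Clim_le (u : nat -> C) (l : C) (v : nat -> R) :
  (forall n, Cmod (u n - l) <= v n)%R -> is_lim_seq v 0 -> Clim u l.
Proof.
intros H Hv; apply Clim_Cmod_minus.
apply is_lim_seq_le_le with (fun _ => 0%R) v; trivial.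
- intros n; split; [apply Cmod_ge_0 | apply H].
- apply is_lim_seq_const.
Qed.

Lemma Clim_ext (u v : nat -> C) (l : C) :
  (forall n, u n = v n) -> Clim u l -> Clim v l.
Proof. intros H; apply filterlim_ext; exact H. Qed.

Lemma Clim_unique (u : nat -> C) (l l' : C) : Clim u l -> Clim u l' -> l = l'.
Proof.
exact (@filterlim_locally_unique nat C_AbsRing C_NormedModule eventually _ u l l').
Qed.

Lemma Clim_const (l : C) : Clim (fun _ => l) l.
Proof. apply filterlim_const. Qed.

Lemma Clim_succ (u : nat -> C) (l : C) : Clim u l -> Clim (fun n => u (S n)) l.
Proof.
rewrite !Clim_Cmod_minus; intros H.
exact (proj1 (is_lim_seq_incr_1 (fun n => Cmod (u n - l)) 0) H).
Qed.

Lemma Clim_minus (u v : nat -> C) (l m : C) :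
  Clim u l -> Clim v m -> Clim (fun n => u n - v n) (l - m).
Proof.
rewrite !(Clim_Cmod_minus u), !(Clim_Cmod_minus v); intros Hu Hv.
apply Clim_le with (fun n => Cmod (u n - l) + Cmod (v n - m))%R.
- intros n; replace (u n - v n - (l - m)) with ((u n - l) + - (v n - m)) by ring.
  rewrite <- (Cmod_opp (v n - m)); apply Cmod_triangle.
- replace (Finite 0) with (Finite (0 + 0)) by (f_equal; ring).
  now apply is_lim_seq_plus'.
Qed.

Lemma Clim_mult (u v : nat -> C) (l m : C) :
  Clim u l -> Clim v m -> Clim (fun n => u n * v n) (l * m).
Proof.
rewrite !(Clim_Cmod_minus u), !(Clim_Cmod_minus v); intros Hu Hv.
apply Clim_le with (fun n => Cmod (u n - l) * Cmod (v n - m)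
  + Cmod (u n - l) * Cmod m + Cmod l * Cmod (v n - m))%R.
- intros n; replace (u n * v n - l * m) with
    ((u n - l) * (v n - m) + (u n - l) * m + l * (v n - m)) by ring.
  rewrite <- !Cmod_mult.
  eapply Rle_trans; [apply Cmod_triangle |].
  apply Rplus_le_compat_r, Cmod_triangle.
- replace (Finite 0) with (Finite (0 * 0 + 0 * Cmod m + Cmod l * 0))
    by (f_equal; ring).
  repeat apply is_lim_seq_plus'; repeat apply is_lim_seq_mult'; trivial;
    apply is_lim_seq_const.
Qed.

Lemma Clim_Cmod (u : nat -> C) (l : C) :
  Clim u l -> is_lim_seq (fun n => Cmod (u n)) (Cmod l).
Proof.
intros H; exact (filterlim_comp _ _ _ u Cmod _ _ _ H
  (@filterlim_norm C_AbsRing C_NormedModule l)).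
Qed.

Lemma Clim_pow (q : C) : (Cmod q < 1)%R -> Clim (fun n => q ^ n) 0.
Proof.
intros Hq; apply Clim_le with (fun n => Cmod q ^ n)%R.
- intros n; replace (q ^ n - 0) with (q ^ n) by ring.
  rewrite Cmod_pow; lra.
- apply is_lim_seq_geom; rewrite Rabs_pos_eq; trivial; apply Cmod_ge_0.
Qed.

(** * Lower bounds for q-Pochhammer symbols *)

Lemma Cminus_neq_0 (x y : C) : y <> x -> x - y <> 0.
Proof.
intros H E; apply H; replace y with (x - (x - y)) by ring; rewrite E; ring.
Qed.

Lemma Cmult_pow_neq_1 (u q : C) : (Cmod q < 1)%R -> (Cmod u < 1)%R ->
  forall N : nat, u * q ^ N <> 1.
Proof.
intros Hq Hu N E; apply (f_equal Cmod) in E; revert E.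
rewrite Cmod_mult, Cmod_pow, Cmod_1; intros E.
assert (Hq0 := Cmod_ge_0 q); assert (Hu0 := Cmod_ge_0 u).
assert (H0 := pow_le (Cmod q) N Hq0).
assert (H1 : (Cmod q ^ N <= 1 ^ N)%R) by (apply pow_incr; lra).
rewrite pow1 in H1; nra.
Qed.

Lemma qPoch_add (u q : C) (N n : nat) :
  qPoch u q (N + n) = qPoch u q N * qPoch (u * q ^ N) q n.
Proof.
induction n as [|n IH].
- rewrite Nat.add_0_r; simpl; ring.
- rewrite Nat.add_succ_r; simpl; rewrite IH, Cpow_add_r; ring.
Qed.

Lemma qPoch_neq_0 (u q : C) (n : nat) :
  (forall N : nat, u * q ^ N <> 1) -> qPoch u q n <> 0.
Proof.
intros H; induction n as [|n IH]; simpl.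
- intros E; injection E; lra.
- apply Cmult_neq_0; trivial; apply Cminus_neq_0, H.
Qed.

(* Weierstrass' inequality: the product of the [1 - x_k] is at least [1] minus
   the sum of the [x_k]. *)
Lemma qPoch_ge_small (u q : C) (n : nat) : (Cmod q < 1)%R ->
  (Cmod u <= (1 - Cmod q) / 2)%R -> (/ 2 <= Cmod (qPoch u q n))%R.
Proof.
intros Hq Hu.
assert (Hq0 := Cmod_ge_0 q); assert (Hu0 := Cmod_ge_0 u).
set (s := (Cmod u / (1 - Cmod q))%R).
assert (Hs : (0 <= s <= / 2)%R).
{ unfold s; split.
  - apply Rmult_le_pos; trivial; left; apply Rinv_0_lt_compat; lra.
  - apply Rmult_le_reg_r with (1 - Cmod q)%R; [lra |].
    unfold Rdiv; rewrite Rmult_assoc, Rinv_l; lra. }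
assert (Hus : Cmod u = (s * (1 - Cmod q))%R) by (unfold s; field; lra).
(* The partial geometric sum of the [Cmod u * Cmod q ^ k] for [k < n] is [s * (1 - Cmod q ^ n)];
   keeping it exact lets the induction close. *)
enough (H : (1 - s * (1 - Cmod q ^ n) <= Cmod (qPoch u q n))%R).
{ assert (H0 := pow_le (Cmod q) n Hq0); nra. }
induction n as [|n IH]; simpl.
- rewrite Cmod_1; lra.
- rewrite Cmod_mult.
  assert (H0 := pow_le (Cmod q) n Hq0).
  assert (H1 : (Cmod q ^ n <= 1 ^ n)%R) by (apply pow_incr; lra).
  rewrite pow1 in H1.
  assert (H2 : (1 - Cmod u * Cmod q ^ n <= Cmod (1 - u * q ^ n))%R).
  { rewrite <- Cmod_pow, <- Cmod_mult.
    assert (H2 := Cmod_triangle (1 - u * q ^ n) (u * q ^ n)).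
    replace (1 - u * q ^ n + u * q ^ n) with (RtoC 1) in H2 by ring.
    rewrite Cmod_1 in H2; lra. }
  set (x := (Cmod q ^ n)%R) in *.
  assert (H3 : (0 <= s * (1 - x) <= 1)%R) by nra.
  assert (H4 : (0 <= Cmod u * x <= 1)%R) by nra.
  apply Rle_trans with ((1 - s * (1 - x)) * (1 - Cmod u * x))%R.
  + rewrite Hus in *; nra.
  + apply Rmult_le_compat; lra.
Qed.

(** Since [u * q ^ N] tends to 0, some shift falls under the threshold of [qPoch_ge_small].
    Induction on that [N], with [u] general, restores the nonzero factors [1 - u], [1 - u * q], ...
    one at a time. *)
Lemma qPoch_ge (u q : C) : (Cmod q < 1)%R ->
  (forall N : nat, u * q ^ N <> 1) ->
  exists m : R, (0 < m)%R /\ forall n, (m <= Cmod (qPoch u q n))%R.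
Proof.
intros Hq Hu.
assert (Hq0 := Cmod_ge_0 q); assert (Hu0 := Cmod_ge_0 u).
assert (HN : exists N, (Cmod (u * q ^ N) <= (1 - Cmod q) / 2)%R).
{ assert (H := Clim_mult _ _ _ _ (Clim_const u) (Clim_pow q Hq)).
  apply Clim_Cmod, is_lim_seq_spec in H; unfold is_lim_seq' in H.
  assert (Hpos : (0 < (1 - Cmod q) / 2)%R) by lra.
  destruct (H (mkposreal _ Hpos)) as [N HN]; exists N.
  specialize (HN N (le_n N)); simpl in HN.
  rewrite Cmult_0_r, Cmod_0, Rminus_0_r in HN.
  apply Rabs_def2 in HN; lra. }
destruct HN as [N HN]; revert u Hu Hu0 HN.
induction N as [|N IH]; intros u Hu Hu0 HN.
- exists (/ 2)%R; split; [lra |]; intros n; apply qPoch_ge_small; trivial.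
  simpl in HN; now rewrite Cmult_1_r in HN.
- destruct (IH (u * q)) as [m [Hm H]].
  + intros k; specialize (Hu (S k)); simpl in Hu; now rewrite <- Cmult_assoc.
  + apply Cmod_ge_0.
  + simpl in HN; now rewrite <- Cmult_assoc.
  + assert (H1 : (0 < Cmod (1 - u))%R).
    { apply Cmod_gt_0, Cminus_neq_0; specialize (Hu O); simpl in Hu.
      now rewrite Cmult_1_r in Hu. }
    (* The 1 covers the empty product, from which no factor can be split off. *)
    exists (Rmin 1 (Cmod (1 - u) * m)); split.
    * apply Rmin_pos; [lra | nra].
    * intros [|n].
      -- simpl; rewrite Cmod_1; apply Rmin_l.
      -- eapply Rle_trans; [apply Rmin_r |].
         change (S n) with (1 + n)%nat; rewrite qPoch_add, Cmod_mult.
         simpl; rewrite !Cmult_1_r, Cmult_1_l.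
         apply Rmult_le_compat_l; [lra | apply H].
Qed.

(** The shifted symbol is the quotient of the symbols of lengths [N + n] and [N]: the first is
    bounded below by [qPoch_ge], the second above by [qPoch_bound], both independently of [N]. *)
Lemma qPoch_shift_ge (u q : C) : (Cmod q < 1)%R ->
  (forall N : nat, u * q ^ N <> 1) ->
  exists m : R, (0 < m)%R /\
    forall N n, (m <= Cmod (qPoch (u * q ^ N) q n))%R.
Proof.
intros Hq Hu; destruct (qPoch_ge u q Hq Hu) as [m [Hm H]].
set (B := exp (Cmod u / (1 - Cmod q))).
assert (HB : (0 < B)%R) by apply exp_pos.
exists (m / B)%R; split; [now apply Rdiv_lt_0_compat |].
intros N n; specialize (H (N + n)%nat).
rewrite qPoch_add, Cmod_mult in H.
assert (H1 := qPoch_bound u q N Hq); fold B in H1.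
apply Rmult_le_reg_r with B; trivial.
unfold Rdiv; rewrite Rmult_assoc, Rinv_l, Rmult_1_r by lra.
eapply Rle_trans; [exact H |].
rewrite Rmult_comm; apply Rmult_le_compat_l; [apply Cmod_ge_0 | exact H1].
Qed.

Lemma qPoch_inf_neq_0 (u q : C) : (Cmod q < 1)%R ->
  (forall N : nat, u * q ^ N <> 1) -> qPoch_inf u q <> 0.
Proof.
intros Hq Hu; destruct (qPoch_ge u q Hq Hu) as [m [Hm H]].
assert (HL := Clim_Cmod _ _ (qPoch_inf_correct u q Hq)).
assert (HL' := is_lim_seq_le _ _ m _ H (is_lim_seq_const m) HL).
simpl in HL'; apply Cmod_gt_0; lra.
Qed.

(** * Geometric domination and convergence of the series *)

(** One [M] serves all shifts: [N = 0] gives convergence of the series, and uniformity in [N] gives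
    the limit along [c * q ^ N]. *)
Lemma qhyp_term_bound (q a b c : C) : (Cmod q < 1)%R ->
  (forall N : nat, c * q ^ N <> 1) ->
  exists M : R, forall (N n : nat) (z : C),
    (Cmod (qhyp_term q a b (c * q ^ N) z n) <= M * Cmod z ^ n)%R.
Proof.
intros Hq Hc.
destruct (qPoch_shift_ge c q Hq Hc) as [m [Hm Hcm]].
destruct (qPoch_ge q q Hq (Cmult_pow_neq_1 q q Hq Hq)) as [m' [Hm' Hqm]].
set (A := exp (Cmod a / (1 - Cmod q))).
set (B := exp (Cmod b / (1 - Cmod q))).
assert (HA : (0 < A)%R) by apply exp_pos.
assert (HB : (0 < B)%R) by apply exp_pos.
exists (A * B * / m * / m')%R; intros N n z.
assert (HcN := Hcm N n); assert (Hqn := Hqm n).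
assert (HcN0 : qPoch (c * q ^ N) q n <> 0) by (apply Cmod_gt_0; lra).
assert (Hqn0 : qPoch q q n <> 0) by (apply Cmod_gt_0; lra).
unfold qhyp_term; rewrite Cmod_mult, !Cmod_div, !Cmod_mult, Cmod_pow by trivial.
replace (A * B * / m * / m' * Cmod z ^ n)%R
  with (A * B * / m * (Cmod z ^ n * / m'))%R by ring.
assert (Hz := pow_le (Cmod z) n (Cmod_ge_0 z)).
unfold Rdiv.
assert (HI : forall x y : R, (0 < x)%R -> (x <= y)%R -> (0 <= / y <= / x)%R).
{ intros x y Hx Hxy; split; [left; apply Rinv_0_lt_compat; lra |].
  now apply Rinv_le_contravar. }
assert (H1 := HI _ _ Hm HcN); assert (H2 := HI _ _ Hm' Hqn).
repeat apply Rmult_le_compat; try apply Rmult_le_pos; try apply Rmult_le_pos;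
  try apply Cmod_ge_0; try apply qPoch_bound; try lra.
Qed.

(** The difference [l - t O] is the sum of the tail, whose partial sums are dominated by geometric
    ones. In [Clim_qhyp_shift], [e] is a multiple of [Cmod q ^ N]. *)
Lemma is_series_Cmod_minus_head (t : nat -> C) (l : C) (e r : R) :
  (0 <= r < 1)%R -> (0 <= e)%R ->
  @is_series C_AbsRing C_NormedModule t l ->
  (forall n, Cmod (t (S n)) <= e * r ^ n)%R ->
  (Cmod (l - t O) <= e / (1 - r))%R.
Proof.
intros Hr He Hl Ht.
replace l with (l - t O + t O) in Hl by ring.
apply (@is_series_incr_1 C_AbsRing C_NormedModule t (l - t O)) in Hl.
apply (Clim_Cmod (@sum_n C_AbelianMonoid (fun n => t (S n)))) in Hl.
refine (is_lim_seq_le _ (fun _ => e / (1 - r))%R _ (e / (1 - r))%R _ Hl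
  (is_lim_seq_const _)).
intros n; apply Rle_trans with (e * ((1 - r ^ S n) / (1 - r)))%R.
- induction n as [|n IH].
  + rewrite sum_O; eapply Rle_trans; [apply Ht |].
    right; simpl; field; lra.
  + rewrite sum_Sn; change plus with Cplus.
    eapply Rle_trans; [apply Cmod_triangle |].
    eapply Rle_trans; [apply Rplus_le_compat; [exact IH | apply Ht] |].
    right; simpl; field; lra.
- unfold Rdiv; apply Rmult_le_compat_l; trivial.
  rewrite <- (Rmult_1_l (/ (1 - r))) at 2; apply Rmult_le_compat_r.
  + left; apply Rinv_0_lt_compat; lra.
  + assert (H := pow_le r (S n) (proj1 Hr)); lra.
Qed.

Lemma qhyp_correct (q a b c z l : C) :
  @is_series C_AbsRing C_NormedModule (qhyp_term q a b c z) l ->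
  qhyp q a b c z = l.
Proof.
intros Hl.
exact (@iota_filterlim_locally C_AbsRing C_CompleteNormedModule nat
         eventually _ (@sum_n C_AbelianMonoid (qhyp_term q a b c z)) l Hl).
Qed.

Lemma ex_series_qhyp (q a b c z : C) : (Cmod q < 1)%R -> (Cmod z < 1)%R ->
  (forall N : nat, c * q ^ N <> 1) ->
  @ex_series C_AbsRing C_NormedModule (qhyp_term q a b c z).
Proof.
intros Hq Hz Hc; destruct (qhyp_term_bound q a b c Hq Hc) as [M HM].
apply (@ex_series_le C_AbsRing C_CompleteNormedModule (qhyp_term q a b c z)
         (fun n => M * Cmod z ^ n)%R).
(* [c * 1] is convertible to [c * q ^ 0], the case [N = 0] of the bound. *)
- intros n; rewrite <- (Cmult_1_r c) at 1.
  exact (HM O n z).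
- apply (@ex_series_scal R_AbsRing R_NormedModule).
  apply ex_series_geom; rewrite Rabs_pos_eq; trivial; apply Cmod_ge_0.
Qed.

(** * The contiguous relation between [c] and [c * q] *)

(* The right-hand side comes from the telescoping ansatz
   [G n = k (1 - q^n) t n], which forces [k = - (1 - c)]. *)
Lemma qhyp_term_contiguous (q a b c : C) : (Cmod q < 1)%R ->
  (forall N : nat, c * q ^ N <> 1) -> a <> 0 -> b <> 0 ->
  let t := qhyp_term q a b c (c / (a * b)) in
  let t' := qhyp_term q a b (c * q) (c * q / (a * b)) in
  forall n : nat,
  (1 - c) * (1 - c / (a * b)) * t n - (1 - c / a) * (1 - c / b) * t' n =
  (1 - c) * (1 - q ^ n) * t n - (1 - c) * (1 - q ^ S n) * t (S n).
Proof.
intros Hq Hc Ha Hb t t' n.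
assert (Hcn := Cminus_neq_0 _ _ (Hc n)).
assert (Hqn := Cminus_neq_0 _ _ (Cmult_pow_neq_1 q q Hq Hq n)).
assert (Pc := qPoch_neq_0 c q n Hc).
assert (Pq := qPoch_neq_0 q q n (Cmult_pow_neq_1 q q Hq Hq)).
assert (Hc1 := Cminus_neq_0 _ _ (Hc O)); simpl in Hc1; rewrite Cmult_1_r in Hc1.
assert (E : qPoch (c * q) q n = qPoch c q n * (1 - c * q ^ n) / (1 - c)).
{ assert (E := qPoch_add c q 1 n); simpl in E.
  rewrite !Cmult_1_r, Cmult_1_l in E; rewrite E; field; trivial. }
unfold t, t', qhyp_term; rewrite E.
unfold Cdiv; rewrite !Cpow_mult_l; simpl.
(* With the powers as atoms, what remains is a rational identity. *)
set (x := q ^ n) in *; set (zc := c ^ n); set (zi := (/ (a * b)) ^ n).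
field; repeat split; trivial.
Qed.

(** Summing [qhyp_term_contiguous] telescopes. The lower boundary term vanishes because
    [1 - q ^ 0 = 0], the upper one in the limit because the terms of a convergent series tend to
    0. *)
Lemma qhyp_sum_contiguous (q a b c : C) : (Cmod q < 1)%R ->
  (forall N : nat, c * q ^ N <> 1) -> a <> 0 -> b <> 0 ->
  let t := qhyp_term q a b c (c / (a * b)) in
  let t' := qhyp_term q a b (c * q) (c * q / (a * b)) in
  forall l l' : C,
  @is_series C_AbsRing C_NormedModule t l ->
  @is_series C_AbsRing C_NormedModule t' l' ->
  (1 - c) * (1 - c / (a * b)) * l = (1 - c / a) * (1 - c / b) * l'.
Proof.
intros Hq Hc Ha Hb t t' l l' Hl Hl'.
assert (Ht := qhyp_term_contiguous q a b c Hq Hc Ha Hb).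
fold t t' in Ht; cbv zeta in Ht.
set (s := @sum_n C_AbelianMonoid t); set (s' := @sum_n C_AbelianMonoid t').
assert (Hs : Clim s l) by exact Hl; assert (Hs' : Clim s' l') by exact Hl'.
assert (E : forall n,
  (1 - c) * (1 - c / (a * b)) * s n - (1 - c / a) * (1 - c / b) * s' n =
  (1 - c) * (q ^ S n - 1) * (s (S n) - s n)).
(* Writing the boundary term as a difference of partial sums makes its limit a multiple of
   [l - l]. *)
{ intros n; replace (s (S n) - s n) with (t (S n)).
  2:{ unfold s; rewrite sum_Sn; change plus with Cplus; ring. }
  induction n as [|n IH].
  - unfold s, s'; rewrite !sum_O, Ht; simpl; ring.
  - unfold s, s'; rewrite !sum_Sn; change plus with Cplus; fold s s'.
    assert (H := Ht (S n)).
    transitivity (((1 - c) * (1 - c / (a * b)) * s n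
                   - (1 - c / a) * (1 - c / b) * s' n) +
      ((1 - c) * (1 - c / (a * b)) * t (S n)
       - (1 - c / a) * (1 - c / b) * t' (S n))); [ring |].
    rewrite IH, H; ring. }
set (k := (1 - c) * (1 - c / (a * b))) in *.
set (k' := (1 - c / a) * (1 - c / b)) in *.
assert (L1 : Clim (fun n => k * s n - k' * s' n) (k * l - k' * l'))
  by (apply Clim_minus; apply Clim_mult; trivial; apply Clim_const).
assert (L2 : Clim (fun n => (1 - c) * (q ^ S n - 1) * (s (S n) - s n))
                  ((1 - c) * (0 - 1) * (l - l))).
{ apply Clim_mult; [apply Clim_mult; [apply Clim_const |] |].
  - apply Clim_minus; [| apply Clim_const].
    exact (Clim_succ _ _ (Clim_pow q Hq)).
  - apply Clim_minus; trivial; now apply Clim_succ. }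
assert (H := Clim_unique _ _ _ (Clim_ext _ _ _ E L1) L2).
replace (k * l) with ((k * l - k' * l') + k' * l') by ring; rewrite H; ring.
Qed.

Lemma Cmod_div_lt_1 (c d : C) : (Cmod c < Cmod d)%R -> (Cmod (c / d) < 1)%R.
Proof.
intros H; assert (H0 := Cmod_ge_0 c).
assert (Hd : d <> 0) by (apply Cmod_gt_0; lra).
rewrite Cmod_div by trivial.
apply Rmult_lt_reg_r with (Cmod d); [lra |].
unfold Rdiv; rewrite Rmult_assoc, Rinv_l; lra.
Qed.

Lemma qhyp_contiguous (q a b c : C) : (Cmod q < 1)%R ->
  (forall N : nat, c * q ^ N <> 1) -> (Cmod c < Cmod (a * b))%R ->
  (1 - c) * (1 - c / (a * b)) * qhyp q a b c (c / (a * b)) =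
  (1 - c / a) * (1 - c / b) * qhyp q a b (c * q) (c * q / (a * b)).
Proof.
intros Hq Hc Habc.
assert (Hc0 := Cmod_ge_0 c); assert (Hq0 := Cmod_ge_0 q).
assert (Hab : a * b <> 0) by (apply Cmod_gt_0; lra).
assert (Ha : a <> 0) by (intros ->; apply Hab; ring).
assert (Hb : b <> 0) by (intros ->; apply Hab; ring).
assert (Hc' : forall N : nat, c * q * q ^ N <> 1)
  by (intros N; rewrite <- Cmult_assoc; exact (Hc (S N))).
assert (Habc' : (Cmod (c * q) < Cmod (a * b))%R) by (rewrite Cmod_mult; nra).
destruct (ex_series_qhyp q a b c (c / (a * b)) Hq (Cmod_div_lt_1 _ _ Habc) Hc)
  as [l Hl].
destruct (ex_series_qhyp q a b (c * q) (c * q / (a * b)) Hq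
            (Cmod_div_lt_1 _ _ Habc') Hc') as [l' Hl'].
rewrite (qhyp_correct _ _ _ _ _ _ Hl), (qhyp_correct _ _ _ _ _ _ Hl').
now apply (qhyp_sum_contiguous q a b c).
Qed.

(** * Iteration and passage to the limit *)

Lemma Cmod_mult_pow_le (u q : C) (N : nat) : (Cmod q < 1)%R ->
  (Cmod (u * q ^ N) <= Cmod u)%R.
Proof.
intros Hq; assert (Hu := Cmod_ge_0 u); assert (Hq0 := Cmod_ge_0 q).
rewrite Cmod_mult, Cmod_pow.
assert (H : (Cmod q ^ N <= 1 ^ N)%R) by (apply pow_incr; lra).
rewrite pow1 in H; nra.
Qed.

Lemma qhyp_iterate (q a b c : C) (N : nat) : (Cmod q < 1)%R ->
  (forall k : nat, c * q ^ k <> 1) -> (Cmod c < Cmod (a * b))%R ->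
  qPoch c q N * qPoch (c / (a * b)) q N * qhyp q a b c (c / (a * b)) =
  qPoch (c / a) q N * qPoch (c / b) q N *
    qhyp q a b (c * q ^ N) (c * q ^ N / (a * b)).
Proof.
intros Hq Hc Habc; induction N as [|N IH]; simpl.
- now rewrite (Cmult_1_r c).
- assert (H := qhyp_contiguous q a b (c * q ^ N) Hq).
  replace (c * (q * q ^ N)) with (c * q ^ N * q) by ring.
  transitivity ((1 - c * q ^ N) * (1 - c / (a * b) * q ^ N) *
    (qPoch c q N * qPoch (c / (a * b)) q N * qhyp q a b c (c / (a * b))));
    [ring |].
  rewrite IH.
  (* The relation at [c * q ^ N] supplies exactly the last factors of the four symbols of length
     [N + 1]. *)
  transitivity (qPoch (c / a) q N * qPoch (c / b) q N *
    ((1 - c * q ^ N) * (1 - c * q ^ N / (a * b)) *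
     qhyp q a b (c * q ^ N) (c * q ^ N / (a * b)))); [unfold Cdiv; ring |].
  rewrite H; [unfold Cdiv; ring | |].
  + intros k; rewrite <- Cmult_assoc, <- Cpow_add_r; apply Hc.
  + eapply Rle_lt_trans; [now apply Cmod_mult_pow_le | exact Habc].
Qed.

(** The head of each series is 1, and the remaining terms sum to at most
    [M * Cmod q ^ N / (1 - Cmod z)] in modulus. *)
Lemma Clim_qhyp_shift (q a b c : C) : (Cmod q < 1)%R ->
  (forall N : nat, c * q ^ N <> 1) -> (Cmod c < Cmod (a * b))%R ->
  Clim (fun N => qhyp q a b (c * q ^ N) (c * q ^ N / (a * b))) 1.
Proof.
intros Hq Hc Habc.
destruct (qhyp_term_bound q a b c Hq Hc) as [M HM].
assert (Hq0 := Cmod_ge_0 q).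
set (z := c / (a * b)).
assert (Hz : (Cmod z < 1)%R) by now apply Cmod_div_lt_1.
assert (Hz0 := Cmod_ge_0 z).
(* The sign of [M] is read off from the bound at index 0, where the power of [Cmod z] is 1. *)
assert (HM0 : (0 <= M)%R).
{ eapply Rle_trans; [apply Cmod_ge_0 |].
  eapply Rle_trans; [apply (HM O O 0) |]; simpl; lra. }
apply Clim_le with (fun N => M * / (1 - Cmod z) * Cmod q ^ N)%R.
- intros N.
  assert (HqN := pow_le (Cmod q) N Hq0).
  assert (HqN1 : (Cmod q ^ N <= 1 ^ N)%R) by (apply pow_incr; lra).
  rewrite pow1 in HqN1.
  replace (c * q ^ N / (a * b)) with (z * q ^ N) by (unfold z, Cdiv; ring).
  assert (Hzq := Cmod_mult_pow_le z q N Hq).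
  destruct (ex_series_qhyp q a b (c * q ^ N) (z * q ^ N) Hq) as [l Hl].
  + lra.
  + intros k; rewrite <- Cmult_assoc, <- Cpow_add_r; apply Hc.
  + rewrite (qhyp_correct _ _ _ _ _ _ Hl).
    replace (RtoC 1) with (qhyp_term q a b (c * q ^ N) (z * q ^ N) 0)
      by (unfold qhyp_term; simpl; field).
    replace (M * / (1 - Cmod z) * Cmod q ^ N)%R
      with (M * Cmod q ^ N / (1 - Cmod z))%R by (field; lra).
    apply is_series_Cmod_minus_head; trivial; [lra | nra |].
    (* Of the [n + 1] factors [Cmod (z * q ^ N)], one is bounded by [Cmod q ^ N] and the other [n]
       by [Cmod z]. *)
    intros n; eapply Rle_trans; [apply HM |].
    rewrite Rmult_assoc; apply Rmult_le_compat_l; trivial.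
    simpl; apply Rmult_le_compat; try apply Cmod_ge_0.
    * apply pow_le, Cmod_ge_0.
    * rewrite Cmod_mult, Cmod_pow; nra.
    * apply pow_incr; split; [apply Cmod_ge_0 | exact Hzq].
- replace (Finite 0) with (Finite (M * / (1 - Cmod z) * 0)) by (f_equal; ring).
  apply is_lim_seq_mult'; [apply is_lim_seq_const |].
  apply is_lim_seq_geom; rewrite Rabs_pos_eq; trivial.
Qed.

Theorem theorem4 (q a b c : C)
  (hc : forall N : nat, c * q ^ N <> 1)
  (hq : (Cmod q < 1)%R)
  (habc : (Cmod c < Cmod (a * b))%R) :
  @ex_series C_AbsRing C_NormedModule (qhyp_term q a b c (c / (a * b))) /\
  qhyp q a b c (c / (a * b)) =
    (qPoch_inf (c / a) q * qPoch_inf (c / b) q) /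
    (qPoch_inf c q * qPoch_inf (c / (a * b)) q).
Proof.
assert (Hz := Cmod_div_lt_1 _ _ habc).
split; [now apply ex_series_qhyp |].
assert (Hlim : forall u, Clim (qPoch u q) (qPoch_inf u q))
  by (intros u; exact (qPoch_inf_correct u q hq)).
assert (H1 := Clim_mult _ _ _ _
  (Clim_mult _ _ _ _ (Hlim c) (Hlim (c / (a * b))))
  (Clim_const (qhyp q a b c (c / (a * b))))).
assert (H2 := Clim_mult _ _ _ _
  (Clim_mult _ _ _ _ (Hlim (c / a)) (Hlim (c / b)))
  (Clim_qhyp_shift q a b c hq hc habc)).
(* Both sides of [qhyp_iterate] are sequences in [N], so their limits agree. *)
assert (E := Clim_unique _ _ _
  (Clim_ext _ _ _ (fun N => qhyp_iterate q a b c N hq hc habc) H1) H2).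
rewrite Cmult_1_r in E; rewrite <- E.
(* Dividing requires nonzero infinite products: [hc] handles [c], and modulus less than 1 handles
   [c / (a * b)]. *)
assert (Hc0 := qPoch_inf_neq_0 c q hq hc).
assert (Hz0 := qPoch_inf_neq_0 _ q hq (Cmult_pow_neq_1 _ q hq Hz)).
field; split; trivial.
Qed.
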